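(* Let $\{P_n(z)\}_{n=0}^\infty$ be a monic OPS with respect to a positive-definite linear functional and let $\{P_n^*(\kappa,z)\}_{n=0}^\infty$ be the corresponding kernel polynomials for some $\kappa\in\mathbb{C}\setminus\mathbb{R}$. If $\{P_n(z)\}_{n=0}^\infty$ is in a Nevai class $\mathcal{N}(a,c)$ (with $c\in\mathbb{R}$, $a\in[0,\infty)$), then $$\lim_{n\to\infty}\frac{P_{n+1}^*(\kappa,z)}{P_n^*(\kappa,z)}=\lim_{n\to\infty}\frac{P_{n+1}(z)}{P_n(z)}=f(z),\qquad f(z)=\frac{(z-c)+\sqrt{(z-c)^2-4a}}{2},$$ where the ratio $P_{n+1}^*(\kappa,z)/P_n^*(\kappa,z)$ converges uniformly on compact subsets of $\mathbb{C}\setminus\mathbb{R}$.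
   Context: A linear functional $\mathcal{L}:\mathbb{C}[z]\to\mathbb{C}$ is positive-definite if $\mathcal{L}[p]>0$ for every polynomial $p$ that is not identically zero and is non-negative on $\mathbb{R}$. A monic orthogonal polynomial system (OPS) with respect to a functional is a sequence of monic polynomials $P_n$ with $\deg P_n=n$, $\mathcal{L}[P_nP_m]=0$ for $n\neq m$, and $\mathcal{L}[P_n^2]\neq0$ for all $n$. A monic OPS satisfies $P_0=1$, $P_1(z)=z-c_1$, $zP_n(z)=P_{n+1}(z)+c_{n+1}P_n(z)+\lambda_{n+1}P_{n-1}(z)$ for $n\ge1$; in the positive-definite case $c_n\in\mathbb{R}$, $\lambda_n>0$, and all zeros of $P_n$ are real. The OPS is in the Nevai class $\mathcal{N}(a,c)$ if $c_n\to c$ and $\lambda_n\to a$. The kernel polynomials are $$P_n^*(\kappa,z)=(z-\kappa)^{-1}\left[P_{n+1}(z)-\frac{P_{n+1}(\kappa)}{P_n(\kappa)}P_n(z)\right],\quad n\ge0;$$ they form the monic OPS for the functional $p\mapsto\mathcal{L}[(z-\kappa)p(z)]$. The branch of the square root in $f$ is holomorphic on $\mathbb{C}\setminus\mathbb{R}$ and behaves like $z+O(1)$ near $z=\infty$. Uniform convergence on a compact set $K$ is understood for all $n$ large enough (depending on $K$) that the denominators do not vanish on $K$. *)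

(* Defs.v *)
From HB Require Import structures.
From mathcomp Require Import all_boot all_order all_algebra.
From mathcomp Require Import all_classical all_reals all_analysis.
From mathcomp Require Import complex.

Set Implicit Arguments.
Unset Strict Implicit.
Unset Printing Implicit Defensive.

Import Order.TTheory GRing.Theory Num.Theory.
Import numFieldNormedType.Exports.

Local Open Scope classical_set_scope.
Local Open Scope ring_scope.
Local Open Scope complex_scope.

(* The metric topology of the modulus, with C a normed space over itself, so
   that [derivable s z 1] is complex differentiability. *)
HB.instance Definition _ (R : realType) := NormedModule.copy R[i] R[i]^o.

Section Definitions.
Variable R : realType.

Definition nonreal : set R[i] := [set z | z \isn't Num.real].

(* In the order of R[i], 0 <= w (resp. 0 < w) means that w is real and
   nonnegative (resp. positive). *)
Definition positive_definite (L : {scalar {poly R[i]}}) : Prop :=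
  forall p : {poly R[i]},
    p != 0 -> (forall x : R, 0 <= p.[x%:C]) -> 0 < L p.

Definition monic_OPS (L : {scalar {poly R[i]}}) (P : nat -> {poly R[i]}) : Prop :=
  [/\ forall n, P n \is monic,
      forall n, size (P n) = n.+1,
      forall n m, n != m -> L (P n * P m) = 0
    & forall n, L (P n ^+ 2) != 0].

(* gam 0, lam 0 and lam 1 play no role: the c_n are indexed from n = 1 and
   the lambda_n from n = 2. *)
Definition recurrence_coefficients (P : nat -> {poly R[i]})
    (gam lam : nat -> R[i]) : Prop :=
  [/\ P 0%N = 1,
      P 1%N = 'X - (gam 1%N)%:P
    & forall n, (0 < n)%N ->
        'X * P n = P n.+1 + gam n.+1 *: P n + lam n.+1 *: P n.-1].

Definition nevai_class (a c : R) (P : nat -> {poly R[i]}) : Prop :=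
  exists gam lam : nat -> R[i],
    [/\ recurrence_coefficients P gam lam,
        gam @ \oo --> c%:C
      & lam @ \oo --> a%:C].

(* The division is exact, the dividend vanishing at k; (P n).[k] != 0 when k is
   not real, since the zeros of P n are real. *)
Definition kernel_poly (P : nat -> {poly R[i]}) (k : R[i]) (n : nat) :
    {poly R[i]} :=
  (P n.+1 - ((P n.+1).[k] / (P n).[k]) *: P n) %/ ('X - k%:P).

(* The last condition reads s z = z + O(1) near infinity; together the three
   conditions determine s on C \ R. *)
Definition sqrt_branch (a c : R) (s : R[i] -> R[i]) : Prop :=
  [/\ forall z, nonreal z -> derivable s z 1,
      forall z, nonreal z -> s z ^+ 2 = (z - c%:C) ^+ 2 - 4 * a%:C
    & exists r M : R, forall z, nonreal z ->
        r%:C <= `|z| -> `|s z - z| <= M%:C].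

Definition limit_fun (c : R) (s : R[i] -> R[i]) (z : R[i]) : R[i] :=
  ((z - c%:C) + s z) / 2.

End Definitions.

(* Main.v *)
Require Import Defs.
From HB Require Import structures.
From mathcomp Require Import all_boot all_order all_algebra.
From mathcomp Require Import all_classical all_reals all_analysis.
From mathcomp Require Import complex.
From mathcomp Require Import ring lra.

Import Order.TTheory GRing.Theory Num.Theory.
Import numFieldNormedType.Exports.

Local Open Scope classical_set_scope.
Local Open Scope ring_scope.
Local Open Scope complex_scope.

(** Write r_n = P_{n+1}/P_n, so that r_{n+1} = z - c_{n+2} - lambda_{n+2}/r_n,
    and let J(w) = Im w / Im z.  Positivity of the functional makes the c_n real
    and the lambda_n positive, whence J(r_n) >= 1.  The limit map
    w |-> z - c - a/w has the fixed points f and a/f, where J(f) >= 1 and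
    J(a/f) <= 0, and it multiplies (w - f)/(w - a/f) by a/f^2, of modulus < 1;
    hence r_n -> f, uniformly where |Im z| is bounded below and |z| above.

    To have no singularity at z = kappa, the kernel polynomials are written
    P*_n = h_n P_n with h_0 = 1 and
    h_{n+1}(z) = 1 + lambda_{n+2} h_n(z) / (r_n(z) r_n(kappa)).
    This affine recurrence is asymptotically contracting, so h_n converges
    uniformly to 1/(1 - a/(f(z) f(kappa))), which does not vanish, and
    P*_{n+1}/P*_n = r_n h_{n+1}/h_n -> f. *)

Import ComplexField.Normc.

Local Notation Re := complex.Re.
Local Notation Im := complex.Im.

(** * The modulus on R[i] as a map to R *)

Section Modulus.
Context {R : realType}.
Implicit Types (x y : R[i]) (t : R).

Lemma normcE_norm x : `|x| = (normc x)%:C.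
Proof. by rewrite normc_def; case: x. Qed.

Lemma normc_triangle x y : normc (x + y) <= normc x + normc y.
Proof. exact: le_normcD. Qed.

Lemma normc_opp x : normc (- x) = normc x.
Proof. exact: normcN. Qed.

Lemma normc_sub x y : normc (x - y) <= normc x + normc y.
Proof. by rewrite -(normc_opp y); exact: normc_triangle. Qed.

Lemma normc_distC x y : normc (x - y) = normc (y - x).
Proof. by rewrite -normc_opp opprB. Qed.

Lemma normc_dist_trans y x z :
  normc (x - z) <= normc (x - y) + normc (y - z).
Proof. by have := normc_triangle (x - y) (y - z); rewrite addrA subrK. Qed.

Lemma normc_ge0 x : 0 <= normc x.
Proof. by case: x => u v; exact: sqrtr_ge0. Qed.

Lemma normc_gt0 x : (0 < normc x) = (x != 0).
Proof.
rewrite lt_neqAle normc_ge0 andbT eq_sym; congr (~~ _).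
apply/eqP/eqP => [/eq0_normc //|->]; exact: normc0.
Qed.

Lemma normc_real t : normc t%:C = `|t|.
Proof. by rewrite /= expr0n /= addr0 sqrtr_sqr. Qed.

Lemma sqr_normcE x : normc x ^+ 2 = Re x ^+ 2 + Im x ^+ 2.
Proof. by case: x => u v /=; rewrite sqr_sqrtr // addr_ge0 ?sqr_ge0. Qed.

Lemma normc_ge_absIm x : `|Im x| <= normc x.
Proof.
rewrite -(@ler_pXn2r _ 2) ?nnegrE ?normr_ge0 ?normc_ge0 //.
by rewrite sqr_normcE real_normK ?num_real // lerDr sqr_ge0.
Qed.

Lemma ImD x y : Im (x + y) = Im x + Im y.
Proof. by case: x y => [? ?] [? ?]. Qed.

Lemma ImB x y : Im (x - y) = Im x - Im y.
Proof. by case: x y => [? ?] [? ?]. Qed.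

Lemma Im_realM t x : Im (t%:C * x) = t * Im x.
Proof. by case: x => [u v] /=; rewrite mul0r addr0. Qed.

Lemma ImV x : Im x^-1 = - Im x / normc x ^+ 2.
Proof. by rewrite sqr_normcE; case: x => u v /=; rewrite mulNr. Qed.

Lemma nonrealE x : nonreal x <-> Im x != 0.
Proof.
by case: x => u v; rewrite /nonreal /= complex_real; split=> /negP/negP.
Qed.

End Modulus.

(** * Contracting recurrences, uniformly in a parameter *)

Section UniformConvergence.
Context {R : realType} {T : Type}.
Implicit Types (D : set T) (w : nat -> T -> R).
Implicit Types (u : nat -> T -> R[i]) (f : T -> R[i]).

(** Applied to nonnegative families, for which an upper bound uniform in [x] amounts to uniform
    convergence to 0. *)
Definition vanish_on D w :=
  forall e : R, 0 < e -> \forall n \near \oo, forall x, D x -> w n x <= e.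

Definition ucvg_on D u f := vanish_on D (fun n x => normc (u n x - f x)).

Lemma vanish_on_le D w w' :
  (\forall n \near \oo, forall x, D x -> w' n x <= w n x) ->
  vanish_on D w -> vanish_on D w'.
Proof.
move=> ww' w0 e e0; near=> n => x Dx.
have : w n x <= e by move: x Dx; near: n; exact: w0.
by apply: le_trans; move: x Dx; near: n.
Unshelve. all: end_near. Qed.

Lemma vanish_onD D w w' :
  vanish_on D w -> vanish_on D w' -> vanish_on D (fun n x => w n x + w' n x).
Proof.
move=> w0 w'0 e e0; have e20 : 0 < e / 2 by rewrite divr_gt0.
near=> n => x Dx; rewrite [e]splitr lerD //; move: x Dx; near: n;
  [exact: w0|exact: w'0].
Unshelve. all: end_near. Qed.

Lemma vanish_onMl D w B : vanish_on D w -> (forall n x, 0 <= w n x) ->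
  vanish_on D (fun n x => B * w n x).
Proof.
move=> w0 wge0 e e0; have B1 : 0 < `|B| + 1 by rewrite ltr_pwDr.
near=> n => x Dx.
have : w n x <= e / (`|B| + 1).
  by move: x Dx; near: n; apply: w0; rewrite divr_gt0.
rewrite ler_pdivlMr // mulrC; apply: le_trans; apply: ler_wpM2r => //.
by rewrite (le_trans (ler_norm B)) // lerDl.
Unshelve. all: end_near. Qed.

Lemma vanish_on_succ D w : vanish_on D w -> vanish_on D (fun n => w n.+1).
Proof.
move=> w0 e e0; have [N _ Nw] := w0 e e0.
by exists N => // n /= Nn; apply: Nw; exact: leqW.
Qed.

Lemma vanish_on_cst D (w : R^nat) : w @ \oo --> 0 -> vanish_on D (fun n _ => w n).
Proof.
move=> /cvgrPdist_le w0 e e0; have [N _ Nw] := w0 e e0.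
exists N => // n Nn x _; have := Nw n Nn.
by rewrite sub0r normrN; apply: le_trans; exact: ler_norm.
Qed.

(** Past some index the factor [q + e] stays below a fixed [p < 1], so the values decay
    geometrically down to a small level. The bound [A] may depend on [n]: it is used at the one
    index where the decay starts. *)
Lemma vanish_on_contraction D w q : 0 <= q < 1 ->
  (forall n x, D x -> 0 <= w n x) ->
  (forall n, exists A, forall x, D x -> w n x <= A) ->
  (forall e : R, 0 < e ->
     \forall n \near \oo, forall x, D x -> w n.+1 x <= (q + e) * w n x + e) ->
  vanish_on D w.
Proof.
move=> /andP[q0 q1] w0 wA wq e e0.
pose p := (1 + q) / 2.
have p0 : 0 <= p by rewrite /p; lra.
have p1 : p < 1 by rewrite /p; lra.
(* Two demands on the tolerance: q + d <= p, and p (e/2) + d <= e/2, so that the recurrence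
   preserves the level e/2. *)
pose d := Num.min ((1 - q) / 2) (e / 2 * (1 - p)).
have d0 : 0 < d.
  rewrite /d lt_min; apply/andP; split; first by lra.
  by apply: mulr_gt0; lra.
have dq : q + d <= p.
  by have : d <= (1 - q) / 2; [rewrite /d ge_min lexx | rewrite /p; lra].
have de : d <= e / 2 * (1 - p) by rewrite /d ge_min lexx orbT.
have [N _ Nw] := wq d d0.
have [A wNA] := wA N.
have geom m x : D x -> w (N + m)%N x <= e / 2 + p ^+ m * `|A|.
  move=> Dx; elim: m => [|m IH].
    rewrite addn0 expr0 mul1r; have := wNA x Dx; have := ler_norm A; lra.
  rewrite addnS exprS; apply: (le_trans (Nw (N + m)%N (leq_addr _ _) x Dx)).
  have wge := w0 (N + m)%N x Dx.
  have : (q + d) * w (N + m)%N x <= p * (e / 2 + p ^+ m * `|A|).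
    by apply: ler_pM => //; lra.
  by rewrite mulrDr mulrA; lra.
have /cvgrPdist_le /(_ (e / 2 / (`|A| + 1))) : (GRing.exp p : R^nat) @ \oo --> 0.
  by apply: cvg_expr; rewrite ger0_norm.
have A1 : 0 < `|A| + 1 by rewrite ltr_pwDr.
move=> /(_ _)[|M _ Mp]; first by rewrite !divr_gt0.
exists (N + M)%N => // n /= NMn x Dx.
have Nn : (N <= n)%N by apply: leq_trans NMn; exact: leq_addr.
rewrite -(subnKC Nn); apply: (le_trans (geom _ x Dx)).
have := Mp (n - N)%N; rewrite /= leq_subRL // => /(_ NMn).
rewrite sub0r normrN ger0_norm ?exprn_ge0 // ler_pdivlMr // mulrDr mulr1.
have := exprn_ge0 (n - N) p0; lra.
Qed.

End UniformConvergence.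

(** * Ratio asymptotics of the recurrence *)

Section RatioAsymptotics.
Context {R : realType}.
Implicit Types (z w x y t : R[i]).

Definition imr z w : R := Im w / Im z.

Lemma imr_le_normc z w : Im z != 0 -> 1 <= imr z w -> `|Im z| <= normc w.
Proof.
move=> z0 zw; apply: le_trans (normc_ge_absIm w).
rewrite -[Im w](divfK z0) normrM -[leLHS]mul1r ler_wpM2r //.
exact: le_trans zw (ler_norm _).
Qed.

(** A real shift does not change the imaginary part, and Im (-t/w) = t Im w / |w|^2. *)
Lemma imr_step z (x t : R) w : Im z != 0 ->
  imr z (z - x%:C - t%:C / w) = 1 + t / normc w ^+ 2 * imr z w.
Proof.
move=> z0; rewrite /imr !ImB Im_realM ImV /= subr0 -[1](divff z0).
by rewrite mulNr mulrN opprK mulrDl; congr (_ + _); ring.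
Qed.

Lemma imr_step_ge1 z (x t : R) w : Im z != 0 -> 0 <= t -> 1 <= imr z w ->
  1 <= imr z (z - x%:C - t%:C / w).
Proof.
move=> z0 t0 zw; rewrite imr_step // lerDl mulr_ge0 ?(le_trans _ zw) //.
by rewrite divr_ge0 ?exprn_ge0 ?normc_ge0.
Qed.

Variables (g l : R^nat) (a c : R).
Hypotheses (l_ge0 : forall n, 0 <= l n) (a_ge0 : 0 <= a).

(** This is P_{n+1}(z)/P_n(z), with shifted indices: [g n] is c_{n+1} and [l n] is lambda_{n+2}. *)
Fixpoint ratio n z : R[i] :=
  if n is m.+1 then z - (g m.+1)%:C - (l m)%:C / ratio m z
  else z - (g 0%N)%:C.

Lemma imr_ratio n z : Im z != 0 -> 1 <= imr z (ratio n z).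
Proof.
move=> z0; elim: n => [|n IH] /=; last exact: imr_step_ge1.
by rewrite /imr ImB /= subr0 divff.
Qed.

(** The limit enters only as a fixed point of w |-> z - c - a/w on the side J >= 1; the square root
    is brought in later. *)
Variable F : R[i] -> R[i].
Hypothesis imrF : forall z, Im z != 0 -> 1 <= imr z (F z).
Hypothesis fixF : forall z, Im z != 0 -> F z = z - c%:C - a%:C / F z.
Hypotheses (g_cvg : g @ \oo --> c) (l_cvg : l @ \oo --> a).

(** For d > 0 these sets exhaust C \ R: each compact subset lies in one of them. *)
Definition region (d M : R) : set R[i] :=
  [set z | d <= `|Im z| /\ normc z <= M].

Variables (d M : R).
Hypothesis d_gt0 : 0 < d.
Local Notation D := (region d M).
(** [B] bounds |F| on [D], by the fixed-point equation and |F| >= d; [q] will bound a/|F|^2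
    there. *)
Let B : R := `|M| + `|c| + a / d.
Let q : R := 1 - d / (B + d).

Lemma region_Im z : D z -> Im z != 0.
Proof. by case=> dz _; rewrite -normr_gt0; exact: lt_le_trans dz. Qed.

Lemma region_imr z w : D z -> 1 <= imr z w -> d <= normc w.
Proof.
move=> Dz zw; have [dz _] := Dz.
exact: le_trans dz (imr_le_normc _ _ (region_Im _ Dz) zw).
Qed.

Let normF_ge z : D z -> d <= normc (F z).
Proof. by move=> Dz; apply: (region_imr _ _ Dz); apply/imrF/region_Im. Qed.

Let norm_ratio_ge n z : D z -> d <= normc (ratio n z).
Proof. by move=> Dz; apply: (region_imr _ _ Dz); apply/imr_ratio/region_Im. Qed.

Let B_ge0 : 0 <= B.
Proof. by rewrite !addr_ge0 // divr_ge0 // ltW. Qed.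

Lemma normF_le z : D z -> normc (F z) <= B.
Proof.
move=> Dz; have [_ zM] := Dz; rewrite fixF ?region_Im //.
apply: (le_trans (normc_sub _ _)); rewrite lerD //.
  apply: (le_trans (normc_sub _ _)); rewrite normc_real lerD2r.
  by rewrite (le_trans zM) // ler_norm.
rewrite normcM normcV normc_real ger0_norm // ler_wpM2l // lef_pV2 ?posrE //.
  exact: normF_ge.
exact: lt_le_trans (normF_ge _ Dz).
Qed.

Let q_bounds : 0 <= q < 1.
Proof.
have Bd : 0 < B + d by rewrite ltr_wpDl.
rewrite /q subr_ge0 gtrBl divr_gt0 // ler_pdivrMr // mul1r lerDr andbT.
exact: B_ge0.
Qed.

(* The two fixed points F z and a / F z of w |-> z - c - a / w have
   multiplicative ratio a / (F z)^2, which is thus uniformly contracting. *)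
Lemma le_sqr_normF z : D z -> a <= q * normc (F z) ^+ 2.
Proof.
move=> Dz; have z0 := region_Im _ Dz.
have := imrF _ z0; set J := imr z (F z) => J1.
have N0 : 0 < normc (F z) by exact: lt_le_trans (normF_ge _ Dz).
(* The equation gives 1 - a/|F|^2 = 1/J, so an upper bound on J keeps a/|F|^2 away from 1; it comes
   from J d <= |Im F| <= B. *)
have JE : J = 1 + a / normc (F z) ^+ 2 * J.
  by rewrite {1}/J {1}fixF // imr_step.
have Bd : 0 < B + d by rewrite ltr_wpDl.
have JB : J * d <= B.
  apply: le_trans (normF_le _ Dz); apply: le_trans (normc_ge_absIm (F z)).
  rewrite -[Im (F z)](divfK z0) normrM -/(imr z (F z)) -/J.
  rewrite ger0_norm ?(le_trans _ J1) // ler_wpM2l ?(le_trans _ J1) //.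
  by case: Dz.
have qJ : (1 - q) * J <= 1.
  rewrite /q opprB addrC subrK mulrAC ler_pdivrMr // mul1r mulrC.
  by apply: (le_trans JB); rewrite lerDl ltW.
rewrite -ler_pdivrMr ?exprn_gt0 //; move: JE; set y := a / _ => JE.
by rewrite -(@ler_pM2r _ J); [lra | lra].
Qed.

(** * Convergence of the ratios through a linearising coordinate *)

Let G z : R[i] := a%:C / F z.
(** Bounds on [D] the error of one step when the coefficients are replaced by their limits, given
    |r_n| >= d. *)
Let delta n : R := `|c - g n.+1| + `|a - l n| / d.

Let delta_cvg : delta @ \oo --> 0.
Proof.
rewrite -[0]addr0 -[in X in _ + X](mul0r d^-1).
apply: cvgD; last apply: cvgMl.
  rewrite -(normr0 R) -(subrr c); apply: cvg_norm.
  apply: cvgB; first exact: cvg_cst.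
  by rewrite (cvg_shiftS g).
rewrite -(normr0 R) -(subrr a); apply: cvg_norm.
by apply: cvgB => //; exact: cvg_cst.
Qed.

Let ratio_near_step n z (e := ratio n.+1 z - (z - c%:C - a%:C / ratio n z)) :
  D z -> normc e <= delta n.
Proof.
move=> Dz; have -> : e = (c - g n.+1)%:C + (a - l n)%:C / ratio n z.
  by rewrite /e /= !rmorphB /= mulrBl; ring.
apply: (le_trans (normc_triangle _ _)).
rewrite normcM normcV !normc_real lerD2l ler_wpM2l // lef_pV2 ?posrE //.
  exact: norm_ratio_ge.
exact: lt_le_trans (norm_ratio_ge _ _ Dz).
Qed.

(** Modulus of the coordinate (w - F)/(w - G), in which the limit map is multiplication by G/F =
    a/F^2. *)
Let cross n z : R := normc (ratio n z - F z) / normc (ratio n z - G z).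

(** Since J(G) = -a J(F)/|F|^2 <= 0, one has J(r_n - G) >= J(r_n) >= 1. *)
Let norm_sub_G n z : D z -> d <= normc (ratio n z - G z).
Proof.
move=> Dz; apply: (region_imr _ _ Dz); have z0 := region_Im _ Dz.
rewrite /imr ImB /G Im_realM ImV mulNr mulrN opprK mulrDl.
apply: le_trans (imr_ratio n _ z0) _; rewrite lerDl.
rewrite -mulrA mulr_ge0 // mulrAC divr_ge0 ?exprn_ge0 ?normc_ge0 //.
exact: le_trans (imrF _ z0).
Qed.

Let norm_G_le z : D z -> normc (G z) <= q * normc (F z).
Proof.
move=> Dz; have N0 : 0 < normc (F z) by exact: lt_le_trans (normF_ge _ Dz).
rewrite /G normcM normcV normc_real ger0_norm // ler_pdivrMr // -mulrA.
exact: le_sqr_normF.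
Qed.

Let norm_FG z : D z -> normc (F z - G z) <= 2 * B.
Proof.
move=> Dz; apply: (le_trans (normc_sub _ _)).
have := norm_G_le _ Dz; have := normF_le _ Dz; have /andP[q0 q1] := q_bounds.
have : q * normc (F z) <= 1 * normc (F z) by rewrite ler_wpM2r ?normc_ge0 // ltW.
lra.
Qed.

Let cross_step n z : D z ->
  cross n.+1 z <= q * cross n z + delta n / d * (1 + q * cross n z).
Proof.
move=> Dz; have z0 := region_Im _ Dz; rewrite /cross.
have F0 : 0 < normc (F z) by exact: lt_le_trans (normF_ge _ Dz).
have r0 : 0 < normc (ratio n z) by exact: lt_le_trans (norm_ratio_ge _ _ Dz).
have := ratio_near_step n _ Dz; set e := (X in normc X) => e_le.
have v0 : 0 < normc (ratio n z - G z) by exact: lt_le_trans (norm_sub_G _ _ Dz).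
have v'd := norm_sub_G n.+1 _ Dz.
have v'0 : 0 < normc (ratio n.+1 z - G z) by exact: lt_le_trans v'd.
have F0' : F z != 0 by rewrite -normc_gt0.
have r0' : ratio n z != 0 by rewrite -normc_gt0.
have aE : a%:C = F z * G z by rewrite /G mulrC divfK.
have FG : z - c%:C = F z + G z by rewrite {1}(fixF _ z0) /G subrK.
(* Here r_{n+1} - F = G (r_n - F)/r_n + e and r_{n+1} - G = F (r_n - G)/r_n + e. Cross-multiplying
   avoids dividing by a perturbed quantity; for e = 0 it is the multiplication by G/F. *)
have Eu : (ratio n.+1 z - F z) * F z * (ratio n z - G z) =
    G z * (ratio n z - F z) * (ratio n.+1 z - G z)
    + e * (F z * (ratio n z - G z) - G z * (ratio n z - F z)).
  have -> : ratio n.+1 z = F z + G z - F z * G z / ratio n z + e.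
    by rewrite /e aE FG; ring.
  by move: e {e_le} => e; field.
have := congr1 (@normc R) Eu; rewrite !normcM => Nu.
set W := normc (ratio n z - F z) in Nu *.
set V := normc (ratio n z - G z) in Nu v0 *.
set W' := normc (ratio n.+1 z - F z) in Nu *.
set V' := normc (ratio n.+1 z - G z) in Nu v'd v'0 *.
have W0 : 0 <= W := normc_ge0 _.
have V0 := ltW v0; have F0w := ltW F0; have V'0 := ltW v'0.
have G_le := norm_G_le _ Dz.
have GW : normc (G z) * W <= q * normc (F z) * W by rewrite ler_wpM2r.
have e0 : 0 <= normc e := normc_ge0 _.
have main : W' * V <= q * W * V' + delta n * (V + q * W).
  rewrite -(ler_pM2l F0).
  have -> : normc (F z) * (W' * V) = W' * normc (F z) * V by ring.
  rewrite Nu; apply: (le_trans (normc_triangle _ _)).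
  rewrite [normc (G z * _ * _)]normcM [normc (G z * _)]normcM.
  rewrite [normc (e * _)]normcM -/W -/V'.
  rewrite [leRHS]mulrDr lerD //.
    rewrite [leRHS](_ : _ = q * normc (F z) * W * V'); last by ring.
    by rewrite ler_wpM2r.
  rewrite [leRHS](_ : _ = delta n * (normc (F z) * V + q * normc (F z) * W));
    last by ring.
  rewrite ler_pM ?normc_ge0 //; apply: (le_trans (normc_sub _ _)).
  by rewrite [normc (F z * _)]normcM [normc (G z * _)]normcM -/V -/W lerD2l.
rewrite ler_pdivrMr // -(ler_pM2r v0); apply: (le_trans main).
(* The extra factor V'/d is at least 1, so the absolute error is absorbed into one relative to
   V'. *)
rewrite [leRHS](_ : _ = q * W * V' + delta n * (V + q * W) * (V' / d));
  last by field; rewrite !gt_eqF.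
rewrite lerD2l ler_peMr //; last by rewrite ler_pdivlMr // mul1r.
apply: mulr_ge0; first exact: le_trans e_le.
by rewrite addr_ge0 // mulr_ge0 //; case/andP: q_bounds.
Qed.

Lemma ratio_ucvg : ucvg_on D ratio F.
Proof.
have /andP[q0 q1] := q_bounds.
have cross0 n z : 0 <= cross n z by rewrite divr_ge0 ?normc_ge0.
have cross_vanish : vanish_on D cross.
  apply: (@vanish_on_contraction _ _ _ _ q) => //.
    move=> n; exists (1 + 2 * B / d) => z Dz; rewrite /cross.
    have v0 : 0 < normc (ratio n z - G z).
      exact: lt_le_trans (norm_sub_G _ _ Dz).
    rewrite ler_pdivrMr // mulrDl mul1r.
    apply: (le_trans (normc_dist_trans (G z) _ _)); rewrite lerD2l.
    rewrite normc_distC; apply: (le_trans (norm_FG _ Dz)).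
    rewrite -[leRHS]mulrA ler_peMr ?mulr_ge0 // mulrC ler_pdivlMr // mul1r.
    exact: norm_sub_G.
  move=> e e0; have /cvgrPdist_le/(_ (e * d)) := delta_cvg.
  move=> /(_ (mulr_gt0 e0 d_gt0)) delta_le.
  near=> n => z Dz; apply: (le_trans (cross_step n _ Dz)).
  have : delta n / d <= e.
    rewrite ler_pdivrMr //.
    have : `|0 - delta n| <= e * d by near: n.
    by rewrite sub0r normrN; apply: le_trans; exact: ler_norm.
  move=> de; rewrite [(q + e) * _]mulrDl -addrA lerD2l.
  apply: (le_trans (ler_wpM2r _ de)); first by rewrite addr_ge0 // mulr_ge0.
  rewrite mulrDr mulr1 [leRHS]addrC lerD2l ler_wpM2l ?(ltW e0) //.
  by rewrite -[leRHS]mul1r ler_wpM2r // ltW.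
(* Back from the coordinate to the distance: |r - F| <= [cross] (|r - F| + 2B), and [cross] <= 1/2
   then gives |r - F| <= 4B [cross]. *)
have := vanish_onMl _ _ (4 * B) cross_vanish cross0.
have := cross_vanish _ (divr_gt0 ltr01 (ltr0Sn R 1)) => half.
apply: vanish_on_le; near=> n => z Dz.
have w12 : cross n z <= 1 / 2 by move: z Dz; near: n.
have v0 : 0 < normc (ratio n z - G z).
  exact: lt_le_trans (norm_sub_G _ _ Dz).
have NE : normc (ratio n z - F z) = cross n z * normc (ratio n z - G z).
  by rewrite /cross divfK // gt_eqF.
have tri : normc (ratio n z - G z) <= normc (ratio n z - F z) + 2 * B.
  apply: (le_trans (normc_dist_trans (F z) _ _)); rewrite lerD2l.
  exact: norm_FG.
have := ler_wpM2l (cross0 n z) tri.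
have := ler_wpM2r (normc_ge0 (ratio n z - F z)) w12.
rewrite -NE mulrDr; nra.
Unshelve. all: end_near. Qed.

(** * Asymptotics of the factors h_n = P*_n / P_n *)

Variable k : R[i].
Hypothesis Dk : D k.

Fixpoint kernel_factor n z : R[i] :=
  if n is m.+1 then
    1 + (l m)%:C / (ratio m z * ratio m k) * kernel_factor m z
  else 1.

(** The recurrence reads h_{n+1} = 1 + [coef] h_n; [H] is the fixed point of its limit h |-> 1 +
    [coef_lim] h. *)
Let coef n z : R[i] := (l n)%:C / (ratio n z * ratio n k).
Let coef_lim z : R[i] := a%:C / (F z * F k).
Let H z : R[i] := (1 - coef_lim z)^-1.

(** Product of the bounds a <= q |F|^2 at [z] and at [k]; having [k] in the same region gives both
    with one [q]. *)
Let norm_coef_lim z : D z -> normc (coef_lim z) <= q.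
Proof.
move=> Dz; have F0 := lt_le_trans d_gt0 (normF_ge _ Dz).
have Fk0 := lt_le_trans d_gt0 (normF_ge _ Dk).
have /andP[q0 _] := q_bounds.
rewrite normcM normcV normcM normc_real ger0_norm // ler_pdivrMr ?mulr_gt0 //.
rewrite -(@ler_pXn2r _ 2) ?nnegrE ?mulr_ge0 ?normc_ge0 //.
have := ler_pM a_ge0 a_ge0 (le_sqr_normF _ Dz) (le_sqr_normF _ Dk).
by rewrite -expr2; congr (_ <= _); ring.
Qed.

Let one_sub_coef z : D z -> 1 - q <= normc (1 - coef_lim z) <= 2.
Proof.
move=> Dz; have xq := norm_coef_lim _ Dz; have /andP[q0 q1] := q_bounds.
have := normc_triangle (1 - coef_lim z) (coef_lim z).
have := normc_sub 1 (coef_lim z); rewrite subrK normc1; lra.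
Qed.

Let one_sub_coef_neq0 z : D z -> 1 - coef_lim z != 0.
Proof.
move=> Dz; rewrite -normc_gt0; have /andP[+ _] := one_sub_coef _ Dz.
by have /andP[q0 q1] := q_bounds; lra.
Qed.

Let norm_H_ge z : D z -> 1 / 2 <= normc (H z).
Proof.
move=> Dz; have /andP[_ x2] := one_sub_coef _ Dz.
rewrite /H normcV div1r lef_pV2 ?posrE //.
by rewrite normc_gt0 one_sub_coef_neq0.
Qed.

Let norm_H_le z : D z -> normc (H z) <= (1 - q)^-1.
Proof.
move=> Dz; have /andP[xq _] := one_sub_coef _ Dz; have /andP[q0 q1] := q_bounds.
rewrite /H normcV lef_pV2 ?posrE ?subr_gt0 //.
by rewrite normc_gt0 one_sub_coef_neq0.
Qed.

Let coef_ucvg : ucvg_on D coef coef_lim.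
Proof.
pose C1 := (d * d)^-1; pose C2 := a / (d * d * d).
have r_cvg := ratio_ucvg.
have rk_cvg : vanish_on D (fun n _ => normc (ratio n k - F k)).
  move=> e e0; near=> n => z _.
  have : forall x, D x -> normc (ratio n x - F x) <= e by near: n; exact: r_cvg.
  by apply.
have l0 : vanish_on D (fun n _ => `|l n - a|).
  apply: vanish_on_cst; rewrite -(normr0 R) -(subrr a); apply: cvg_norm.
  by apply: cvgB => //; exact: cvg_cst.
have := vanish_onD _ _ _ (vanish_onMl _ _ C1 l0 (fun n _ => normr_ge0 _))
  (vanish_onMl _ _ C2 (vanish_onD _ _ _ r_cvg rk_cvg)
    (fun n z => addr_ge0 (normc_ge0 _) (normc_ge0 _))).
apply: vanish_on_le; apply: nearW => n z Dz.
have Fd := normF_ge _ Dz; have Fkd := normF_ge _ Dk.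
have rd := norm_ratio_ge n _ Dz; have rkd := norm_ratio_ge n _ Dk.
have pos x : d <= normc x -> x != 0.
  by move=> dx; rewrite -normc_gt0; exact: lt_le_trans dx.
(* Telescoping: [l n] is replaced by [a], then r_n(z) by F(z), then r_n(k) by F(k). All denominators
   are at least d in modulus. *)
have -> : coef n z - coef_lim z =
    (l n - a)%:C / (ratio n z * ratio n k)
    + (a%:C * (F z - ratio n z) / (F z * ratio n z * ratio n k)
       + a%:C * (F k - ratio n k) / (F z * F k * ratio n k)).
  rewrite /coef /coef_lim rmorphB /=.
  move: Fd Fkd rd rkd => /pos ? /pos ? /pos ? /pos ?.
  by field; apply/and4P.
have inv2 x y : d <= normc x -> d <= normc y -> (normc (x * y))^-1 <= C1.
  move=> dx dy; rewrite /C1 lef_pV2 ?posrE ?mulr_gt0 //; last first.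
    by rewrite normcM mulr_gt0 // (lt_le_trans d_gt0).
  by rewrite normcM ler_pM // ltW.
have inv3 x y t : d <= normc x -> d <= normc y -> d <= normc t ->
    (normc (x * y * t))^-1 <= (d * d * d)^-1.
  move=> dx dy dt; rewrite lef_pV2 ?posrE ?mulr_gt0 //; last first.
    by rewrite !normcM !mulr_gt0 // (lt_le_trans d_gt0).
  by rewrite !normcM !ler_pM ?mulr_ge0 // ltW.
apply: (le_trans (normc_triangle _ _)); rewrite lerD //.
  rewrite normcM normc_real normcV mulrC ler_wpM2r //; exact: inv2.
apply: (le_trans (normc_triangle _ _)); rewrite [leRHS]mulrDr lerD //.
  rewrite normcM normcV normcM normc_real ger0_norm // normc_distC.
  by rewrite /C2 mulrAC ler_wpM2r ?normc_ge0 // ler_wpM2l // inv3.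
rewrite normcM normcV normcM normc_real ger0_norm // normc_distC.
by rewrite /C2 mulrAC ler_wpM2r ?normc_ge0 // ler_wpM2l // inv3.
Unshelve. all: end_near. Qed.

(** As H = 1 + [coef_lim] H, the error obeys h_{n+1} - H = [coef] (h_n - H) + ([coef] - [coef_lim])
    H: asymptotically a contraction by q with vanishing forcing. *)
Let kernel_factor_ucvg : ucvg_on D kernel_factor H.
Proof.
have /andP[q0 q1] := q_bounds.
pose E n z := normc (kernel_factor n z - H z).
have E_step n z : D z ->
    E n.+1 z <= normc (coef n z) * E n z
                + normc (coef n z - coef_lim z) * (1 - q)^-1.
  move=> Dz; rewrite /E -/(coef n z) /=.
  have -> : 1 + coef n z * kernel_factor n z - H z =
      coef n z * (kernel_factor n z - H z) + (coef n z - coef_lim z) * H z.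
    have HE : 1 + coef_lim z * H z = H z.
      have := one_sub_coef_neq0 _ Dz; rewrite /H.
      by move: (coef_lim z) => x x1; field.
    by rewrite -{1}HE; ring.
  apply: (le_trans (normc_triangle _ _)); rewrite !normcM lerD2l.
  by rewrite ler_wpM2l ?normc_ge0 // norm_H_le.
have norm_coef n z : D z -> normc (coef n z) <= l n / (d * d).
  move=> Dz; rewrite normcM normcV normcM normc_real ger0_norm //.
  have rd := norm_ratio_ge n _ Dz; have rkd := norm_ratio_ge n _ Dk.
  rewrite ler_wpM2l // lef_pV2 ?posrE ?mulr_gt0 ?(lt_le_trans d_gt0) //.
  by rewrite ler_pM // ltW.
apply: (@vanish_on_contraction _ _ _ E q) => //.
- by move=> n z _; exact: normc_ge0.
- elim=> [|n [A EA]].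
    exists (1 + (1 - q)^-1) => z Dz; rewrite /E /=.
    apply: (le_trans (normc_sub _ _)); rewrite normc1 lerD2l; exact: norm_H_le.
  pose x := l n / (d * d).
  exists (x * A + (x + q) * (1 - q)^-1) => z Dz.
  apply: (le_trans (E_step n z Dz)); rewrite lerD //.
    by apply: ler_pM; rewrite ?normc_ge0 // ?norm_coef // EA.
  rewrite ler_wpM2r ?invr_ge0 ?subr_ge0 ?(ltW q1) //.
  apply: (le_trans (normc_sub _ _)); apply: lerD; first exact: norm_coef.
  exact: norm_coef_lim.
(* With this [e'], both |[coef]| <= q + e and the forcing e'/(1 - q) <= e hold. *)
- move=> e e0; pose e' := Num.min e (e * (1 - q)).
  have q1' : 0 < 1 - q by rewrite subr_gt0.
  have e'0 : 0 < e' by rewrite /e' lt_min e0 mulr_gt0.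
  near=> n => z Dz; apply: (le_trans (E_step n z Dz)).
  have : normc (coef n z - coef_lim z) <= e'.
    by move: z Dz; near: n; exact: coef_ucvg.
  rewrite /e' le_min => /andP[ce ceq]; apply: lerD; last first.
    by rewrite ler_pdivrMr.
  rewrite ler_wpM2r ?normc_ge0 //.
  have := normc_triangle (coef n z - coef_lim z) (coef_lim z).
  rewrite subrK; have := norm_coef_lim _ Dz; lra.
Unshelve. all: end_near. Qed.

Let kernel_factor_ge :
  \forall n \near \oo, forall z, D z -> 1 / 4 <= normc (kernel_factor n z).
Proof.
have e0 : 0 < 1 / 4 :> R by lra.
near=> n => z Dz.
have : normc (kernel_factor n z - H z) <= 1 / 4.
  by move: z Dz; near: n; exact: kernel_factor_ucvg.
have := normc_triangle (H z - kernel_factor n z) (kernel_factor n z).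
have := norm_H_ge _ Dz; rewrite subrK normc_distC; lra.
Unshelve. all: end_near. Qed.

Lemma kernel_factor_neq0 :
  \forall n \near \oo, forall z, D z -> kernel_factor n z != 0.
Proof.
near=> n => z Dz; rewrite -normc_gt0.
have : 1 / 4 <= normc (kernel_factor n z).
  by move: z Dz; near: n; exact: kernel_factor_ge.
lra.
Unshelve. all: end_near. Qed.

(** h_{n+1} and h_n have the same limit H, bounded away from 0, so their quotient tends to 1. In the
    estimate 4 bounds 1/|h_n|, [C] bounds |h_{n+1}| and [B] bounds |F|. *)
Lemma kernel_ratio_ucvg :
  ucvg_on D (fun n z => ratio n z * (kernel_factor n.+1 z / kernel_factor n z)) F.
Proof.
have /andP[q0 q1] := q_bounds.
pose C := (1 - q)^-1 + 1.
have C0 : 0 <= C by rewrite addr_ge0 // invr_ge0 subr_ge0 ltW.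
have f_cvg := kernel_factor_ucvg.
have f'_cvg := @vanish_on_succ _ _ _ _ f_cvg.
have := vanish_onD _ _ _
  (vanish_onMl _ _ (4 * C) ratio_ucvg (fun n z => normc_ge0 _))
  (vanish_onMl _ _ (4 * B) (vanish_onD _ _ _ f'_cvg f_cvg)
    (fun n z => addr_ge0 (normc_ge0 _) (normc_ge0 _))).
apply: vanish_on_le; near=> n => z Dz.
have f4 : 1 / 4 <= normc (kernel_factor n z).
  by move: z Dz; near: n; exact: kernel_factor_ge.
have f'1 : normc (kernel_factor n.+1 z - H z) <= 1.
  by move: z Dz {f4}; near: n; exact: f'_cvg.
move: f4 f'1; set f := kernel_factor n z; set f' := kernel_factor n.+1 z.
move=> f4 f'1; have f0 : f != 0 by rewrite -normc_gt0; lra.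
have f'C : normc f' <= C.
  have := normc_triangle (f' - H z) (H z); rewrite subrK.
  have := norm_H_le _ Dz; rewrite /C; lra.
have -> : ratio n z * (f' / f) - F z =
    ((ratio n z - F z) * f' + F z * ((f' - H z) - (f - H z))) / f.
  by field.
rewrite normcM normcV ler_pdivrMr ?normc_gt0 //.
apply: (le_trans (normc_triangle _ _)); rewrite !normcM.
have A1 := ler_pM (normc_ge0 _) (normc_ge0 _)
  (lexx (normc (ratio n z - F z))) f'C.
have A2 := ler_pM (normc_ge0 _) (normc_ge0 _) (normF_le _ Dz)
  (normc_sub (f' - H z) (f - H z)).
apply: (le_trans (lerD A1 A2)).
set X := normc (ratio n z - F z) in A1 *.
set Y := _ + normc (f - H z) in A2 *.
rewrite [leLHS](_ : _ = (4 * C * X + 4 * B * Y) * (1 / 4)); last by field.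
rewrite ler_wpM2l // addr_ge0 // mulr_ge0 // ?mulr_ge0 // ?normc_ge0 //.
by rewrite addr_ge0 ?normc_ge0.
Unshelve. all: end_near. Qed.

End RatioAsymptotics.

(** * Positivity of the recurrence coefficients *)

Section RecurrenceCoefficients.
Context {R : realType}.
Variables (L : {scalar {poly R[i]}}) (P : nat -> {poly R[i]}).
Variables (gam lam : nat -> R[i]).
Hypotheses (L_posdef : positive_definite L) (P_OPS : monic_OPS L P).
Hypothesis P_rec : recurrence_coefficients P gam lam.

(** Being real on the real line makes p^2 nonnegative there, which is what positivity of [L] can be
    applied to. *)
Let real_valued (p : {poly R[i]}) := forall x : R, p.[x%:C] \is Num.real.

Let realC_real (x : R) : x%:C \is Num.real.
Proof. by rewrite complex_real. Qed.

Let L_sqr_gt0 p : p != 0 -> real_valued p -> 0 < L (p ^+ 2).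
Proof.
move=> p0 pR; apply: L_posdef => [|x]; first by rewrite expf_neq0.
by rewrite horner_exp real_exprn_even_ge0.
Qed.

(* 4 X p^2 = ((X + 1) p)^2 - ((X - 1) p)^2 is a difference of squares. *)
Let L_X_sqr_real p : p != 0 -> real_valued p -> L ('X * p ^+ 2) \is Num.real.
Proof.
move=> p0 pR.
have lin_gt0 (t : R) : 0 < L ((('X - t%:C%:P) * p) ^+ 2).
  apply: L_sqr_gt0; first by rewrite mulf_neq0 ?polyXsubC_eq0.
  by move=> x; rewrite hornerM hornerXsubC rpredM ?rpredB.
have E : L ('X * p ^+ 2) =
    (L ((('X - (-1)%:C%:P) * p) ^+ 2) - L ((('X - 1%:C%:P) * p) ^+ 2)) / 4.
  rewrite -linearB /= [4]/(4%:R) [X in L X / _](_ : _ = 4 *: ('X * p ^+ 2)).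
    by rewrite linearZ /= mulrAC divff ?mul1r // pnatr_eq0.
  by rewrite !rmorphN !rmorph1 scaler_nat; ring.
by rewrite E rpredM ?rpredB ?gtr0_real ?invr_gt0 ?ltr0n.
Qed.

Let P_neq0 n : P n != 0.
Proof. by case: P_OPS => mon _ _ _; exact: monic_neq0. Qed.

Let P0 : P 0%N = 1. Proof. by case: P_rec. Qed.

Let P1 : P 1%N = 'X - (gam 1%N)%:P. Proof. by case: P_rec. Qed.

Let P_succ n : 'X * P n.+1 = P n.+2 + gam n.+2 *: P n.+1 + lam n.+2 *: P n.
Proof. by case: P_rec => _ _ /(_ n.+1 isT). Qed.

Let orth n m : n != m -> L (P n * P m) = 0.
Proof. by case: P_OPS => _ _ + _; apply. Qed.

(** Pair the recurrence for X P_n with P_n: orthogonality leaves the middle term. The case n = 0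
    uses the formula for P_1. *)
Let gam_L n : gam n.+1 * L (P n ^+ 2) = L ('X * P n ^+ 2).
Proof.
case: n => [|n].
  have -> : 'X * P 0%N ^+ 2 = P 1%N * P 0%N + gam 1%N *: P 0%N ^+ 2.
    by rewrite P1 P0 -mul_polyC; ring.
  by rewrite linearD linearZ /= orth // add0r.
rewrite expr2 mulrA P_succ !mulrDl -!scalerAl !linearD !linearZ /=.
by rewrite (orth n.+2) ?(orth n) ?mulr0 ?addr0 ?add0r // neq_ltn ltnSn ?orbT.
Qed.

(** L(X P_{n+1} P_n) computed twice, expanding X P_{n+1} and then X P_n. *)
Let lam_L n : lam n.+2 * L (P n ^+ 2) = L (P n.+1 ^+ 2).
Proof.
have -> : lam n.+2 * L (P n ^+ 2) = L ('X * P n.+1 * P n).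
  rewrite P_succ !mulrDl -!scalerAl !linearD !linearZ /= expr2.
  rewrite (orth n.+2) ?(orth n.+1) ?mulr0 ?add0r //;
    by rewrite neq_ltn !ltnS ?leqnn ?leqnSn ?orbT.
rewrite mulrAC; case: n => [|n].
  have -> : 'X * P 0%N * P 1%N = P 1%N ^+ 2 + gam 1%N *: (P 0%N * P 1%N).
    by rewrite P1 P0 -mul_polyC; ring.
  by rewrite linearD linearZ /= orth // mulr0 addr0.
rewrite P_succ !mulrDl -!scalerAl !linearD !linearZ /= expr2.
rewrite (orth n.+1) ?(orth n) ?mulr0 ?addr0 //;
  by rewrite neq_ltn !ltnS ?leqnn ?leqnSn.
Qed.

Let gam_real n : real_valued (P n) -> gam n.+1 \is Num.real.
Proof.
move=> Pn; have L0 := L_sqr_gt0 _ (P_neq0 n) Pn.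
rewrite -(mulfK (lt0r_neq0 L0) (gam n.+1)) gam_L.
apply: rpredM; first exact: (L_X_sqr_real _ (P_neq0 n) Pn).
by rewrite rpredV; exact: gtr0_real.
Qed.

Let lam_gt0 n : real_valued (P n) -> real_valued (P n.+1) -> 0 < lam n.+2.
Proof.
move=> Pn Pn1; have L0 := L_sqr_gt0 _ (P_neq0 n) Pn.
rewrite -(mulfK (lt0r_neq0 L0) (lam n.+2)) lam_L divr_gt0 //.
exact: (L_sqr_gt0 _ (P_neq0 n.+1) Pn1).
Qed.

(** Two-step induction: P_n and P_{n+1} real on R give c_{n+2} real and lambda_{n+2} > 0, and the
    recurrence then makes P_{n+2} real there. *)
Let P_real n : real_valued (P n).
Proof.
suff : real_valued (P n) /\ real_valued (P n.+1) by case.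
elim: n => [|n [Pn Pn1]].
  have P0R : real_valued (P 0%N) by move=> x; rewrite P0 hornerC rpred1.
  split=> // x; rewrite P1 hornerXsubC rpredB // gam_real //.
split=> // x.
have -> : P n.+2 = 'X * P n.+1 - gam n.+2 *: P n.+1 - lam n.+2 *: P n.
  by rewrite P_succ; ring.
rewrite !(hornerD, hornerN, hornerM, hornerX, hornerZ).
by rewrite !rpredB ?rpredM ?gam_real // gtr0_real // lam_gt0.
Qed.

Lemma recurrence_coefficients_real :
  exists g l : R^nat, [/\ forall n, gam n.+1 = (g n)%:C,
    forall n, lam n.+2 = (l n)%:C & forall n, 0 <= l n].
Proof.
exists (fun n => Re (gam n.+1)), (fun n => Re (lam n.+2)).
split=> n.
- by rewrite RRe_real // gam_real.
- by rewrite RRe_real // gtr0_real // lam_gt0.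
- by have := lam_gt0 _ (P_real n) (P_real n.+1); rewrite ltcE => /andP[_ /ltW].
Qed.

End RecurrenceCoefficients.

(** * The branch of the square root *)

Section SquareRootBranch.
Context {R : realType}.
Implicit Types (z w : R[i]).

Lemma normc_lipschitz_continuous (f : R[i] -> R) :
  (forall z w, `|f z - f w| <= normc (z - w)) -> continuous f.
Proof.
move=> f_lip z; have FF : Filter (nbhs (z : R[i])) by exact: nbhs_filter.
apply/cvgrPdist_lt => e e0.
have eC : 0 < e%:C :> R[i] by rewrite ltcR.
near=> w; apply: le_lt_trans (f_lip _ _) _.
rewrite -ltcR -normcE_norm; near: w.
have /cvgrPdist_lt : (fun w : R[i] => w) @ z --> z by exact: cvg_id.
by apply.
Unshelve. all: end_near. Qed.

Lemma Im_continuous : continuous (@Im R).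
Proof.
by apply: normc_lipschitz_continuous => z w; rewrite -ImB normc_ge_absIm.
Qed.

Lemma normc_continuous : continuous (@normc R).
Proof.
apply: normc_lipschitz_continuous => z w; rewrite ler_norml.
have := normc_triangle (z - w) w; have := normc_triangle (w - z) z.
rewrite !subrK normc_distC => ? ?; apply/andP; split; lra.
Qed.

Lemma vertical_line_continuous (u v : R) :
  continuous (fun t : R => u +i* (v * (1 + t)) : R[i]).
Proof.
move=> t; apply/cvgrPdist_lt => e e0.
have [re e_eq] : exists re : R, e = re%:C.
  by exists (Re e); rewrite RRe_real // gtr0_real.
have re0 : 0 < re by move: e0; rewrite e_eq ltcR.
near=> x; rewrite normcE_norm e_eq ltcR.
have -> : (u +i* (v * (1 + t))) - (u +i* (v * (1 + x))) = 'i * (v * (t - x))%:C.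
  by apply/eqP; rewrite eq_complex /=; apply/andP; split; apply/eqP; ring.
rewrite normcM normc_real [normc 'i]/= expr0n /= add0r expr1n sqrtr1 mul1r.
rewrite normrM (@le_lt_trans _ _ ((`|v| + 1) * `|t - x|)) //.
  by rewrite ler_wpM2r // lerDl.
rewrite mulrC -ltr_pdivlMr ?ltr_pwDr //; near: x.
have /cvgrPdist_lt : (fun x : R => x) @ t --> t by exact: cvg_id.
apply.
by rewrite divr_gt0 // ltr_pwDr.
Unshelve. all: end_near. Qed.

Variables (a c : R) (s : R[i] -> R[i]).
Hypotheses (a_ge0 : 0 <= a) (s_branch : sqrt_branch a c s).
Local Notation F := (limit_fun c s).

Lemma limit_fun_root z : Im z != 0 -> F z ^+ 2 = (z - c%:C) * F z - a%:C.
Proof.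
move=> /nonrealE nz; case: s_branch => _ /(_ z nz) s2 _.
rewrite /limit_fun; set u := z - c%:C in s2 *.
have -> : a%:C = (u ^+ 2 - s z ^+ 2) / 4 by rewrite s2; field.
by field.
Qed.

(** A nonzero root satisfies w = z - c - a/w, so J = 1 + (a/|w|^2) J, and J > 0 forces J >= 1. The
    root 0 has J = 0. *)
Lemma root_imr_dichotomy z w : Im z != 0 ->
  w ^+ 2 = (z - c%:C) * w - a%:C -> imr z w <= 0 \/ 1 <= imr z w.
Proof.
move=> z0 w2; have [->|w0] := eqVneq w 0; first by left; rewrite /imr /= mul0r.
have wE : w = z - c%:C - a%:C / w.
  by apply: (mulIf w0); rewrite -expr2 w2; field.
have [|J0] := leP (imr z w) 0; [by left|right].
rewrite {1}wE imr_step // lerDl mulr_ge0 ?(ltW J0) //.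
by rewrite divr_ge0 // exprn_ge0 // normc_ge0.
Qed.

(* imr z (F z) never takes values in ]0, 1[ and tends to 1 along the vertical
   ray from z, so it is at least 1 along the whole ray. *)
Lemma limit_fun_imr z : Im z != 0 -> 1 <= imr z (F z).
Proof.
move=> z0; pose zt (t : R) : R[i] := Re z +i* (Im z * (1 + t)).
pose h t := imr (zt t) (F (zt t)).
have zt_im (t : R) : 0 <= t -> Im (zt t) != 0.
  by move=> t0; rewrite /= mulf_neq0 // gt_eqF // ltr_wpDr.
have h_dich (t : R) : 0 <= t -> h t <= 0 \/ 1 <= h t.
  by move=> t0; apply: root_imr_dichotomy; [|apply: limit_fun_root]; exact: zt_im.
have hE t : h t = (Im z * (1 + t) + Im (s (zt t))) / 2 / (Im z * (1 + t)).
  have half w : Im (w / 2) = Im w / 2.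
    have -> : w / 2 = 2^-1%:C * w by rewrite fmorphV rmorph_nat mulrC.
    by rewrite Im_realM mulrC.
  by rewrite /h /imr /limit_fun half ImD ImB /= subr0.
have h_cont (t : R) : 0 <= t -> {for t, continuous h}.
  move=> t0; rewrite (funext hE : h = _).
  have zt_cont : {for t, continuous zt} by exact: vertical_line_continuous.
  have lin_cont : {for t, continuous (fun u : R => Im z * (1 + u))}.
    apply: (@continuousM R R (cst (Im z)) (fun u : R => 1 + u)).
      exact: cst_continuous.
    apply: (@continuousD R R R (cst 1) id); first exact: cst_continuous.
    exact: cvg_id.
  (* Holomorphy of the branch enters here, as continuity along the ray. *)
  have s_cont : {for t, continuous (fun u : R => Im (s (zt u)))}.
    apply: (@continuous_comp _ _ _ zt (@Im R \o s)) => //.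
    apply: continuous_comp; last exact: Im_continuous.
    apply: differentiable_continuous; apply/derivable1_diffP.
    by case: s_branch => + _ _; apply; apply/nonrealE/zt_im.
  apply: cvgM; last by apply: cvgV => //; exact: zt_im.
  by apply: cvgM; [exact: cvgD|exact: cvg_cst].
have h0 : h 0 = imr z (F z).
  by rewrite /h (_ : zt 0 = z) // /zt addr0 mulr1; case: (z).
have [//|J0] := leP 1 (imr z (F z)); exfalso.
have {}h0 : h 0 <= 0 by case: (h_dich 0) => //; rewrite h0 leNgt J0.
have [r [M sM]] : exists r M : R, forall z, Im z != 0 ->
    r <= normc z -> normc (s z - z) <= M.
  case: s_branch => _ _ [r [M rM]]; exists r, M => w /nonrealE nw rw.
  by have := rM w nw; rewrite !normcE_norm !lecR; apply.
have y0 : 0 < `|Im z| by rewrite normr_gt0.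
(* Makes |Im (zt T)| = |Im z| + |r| + |M|: the asymptotic bound on s applies there, and its error is
   below |Im (zt T)|, whence h T > 1/2. *)
pose T := (`|r| + `|M|) / `|Im z|.
have T0 : 0 <= T by rewrite divr_ge0 // addr_ge0.
have yT : `|Im (zt T)| = `|Im z| + `|r| + `|M|.
  rewrite /= normrM (ger0_norm (addr_ge0 ler01 T0)) mulrDr mulr1 /T mulrC.
  by rewrite divfK ?gt_eqF // addrA.
have hT : 0 < h T.
  have : normc (s (zt T) - zt T) <= M.
    apply: sM; first exact: zt_im.
    apply: le_trans (normc_ge_absIm _); rewrite yT.
    have := ler_norm r; have := normr_ge0 M; lra.
  move=> /(le_trans (normc_ge_absIm _)); rewrite ImB.
  rewrite hE -[Im z * _]/(Im (zt T)); move: (zt_im _ T0) yT.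
  move: (Im (zt T)) (Im (s (zt T))) => y y' yn0 yT y'M.
  have -> : (y + y') / 2 / y = (2 + (y' - y) / y) / 2 by field.
  have : `|(y' - y) / y| < 1.
    rewrite normrM normfV ltr_pdivrMr ?normr_gt0 // mul1r yT.
    have := ler_norm M; have := normr_ge0 r; lra.
  rewrite ltr_norml => /andP[]; lra.
(* By the dichotomy h T >= 1 while h 0 <= 0, so h would take the forbidden value 1/2. *)
have [t t0 ht] : exists2 t, t \in `[0, T] & h t = 1 / 2.
  apply: IVT => //.
    apply: continuous_in_subspaceT => t /[!inE] /= /[!in_itv] /= /andP[t0 _].
    exact: h_cont.
  have : 1 <= h T by case: (h_dich _ T0) => //; lra.
  move=> hT1; rewrite ge_min le_max.
  by apply/andP; split; apply/orP; [left|right]; lra.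
have /andP[t_ge0 _] : 0 <= t <= T by rewrite in_itv in t0.
by case: (h_dich _ t_ge0); lra.
Qed.

Lemma limit_fun_fixed z : Im z != 0 -> F z = z - c%:C - a%:C / F z.
Proof.
move=> z0; have F0 : F z != 0.
  rewrite -normc_gt0.
  apply: lt_le_trans (imr_le_normc _ _ z0 (limit_fun_imr _ z0)).
  by rewrite normr_gt0.
by apply: (mulIf F0); rewrite -expr2 limit_fun_root //; field.
Qed.

End SquareRootBranch.

(** * Compact subsets of C \ R *)

Section CompactUniform.
Context {R : realType}.

(** |z| and 1/Im z are continuous on K, hence bounded; [d] is the inverse of the second bound. *)
Lemma compact_sub_region (K : set R[i]) :
  compact K -> K `<=` @nonreal R ->
  exists d M : R, 0 < d /\ K `<=` region d M.
Proof.
move=> cK Knr.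
have Kim z : K z -> Im z != 0 by move=> /Knr/nonrealE.
have bounded_image (f : R[i] -> R) : {within K, continuous f} ->
    exists2 M : R, 0 < M & forall z, K z -> `|f z| <= M.
  move=> /continuous_compact/(_ cK)/compact_bounded [M [_ fM]].
  exists (`|M| + 1); first by rewrite ltr_pwDr.
  move=> z Kz; apply: (fM (`|M| + 1)); last by exists z.
  by have := ler_norm M; lra.
have [M M0 KM] := bounded_image _ (continuous_subspaceT normc_continuous).
have [e e0 Ke] : exists2 M : R, 0 < M & forall z, K z -> `|(Im z)^-1| <= M.
  apply: bounded_image; apply: continuous_in_subspaceT => z /[!inE] Kz.
  apply: continuousV; [exact: Kim|exact: Im_continuous].
exists e^-1, M; split=> [|z Kz]; first by rewrite invr_gt0.
split; last exact: le_trans (ler_norm _) (KM _ Kz).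
have := Ke _ Kz; rewrite normfV => Kez.
by rewrite -[leRHS]invrK lef_pV2 ?posrE ?invr_gt0 ?normr_gt0 ?Kim.
Qed.

Lemma regionS (d d' M M' : R) : d' <= d -> M <= M' ->
  region d M `<=` region d' M'.
Proof.
by move=> dd MM z [dz zM]; split; [exact: le_trans dz|exact: le_trans MM].
Qed.

Lemma ucvg_onS {T : Type} (D D' : set T) u (f : T -> R[i]) :
  D' `<=` D -> ucvg_on D u f -> ucvg_on D' u f.
Proof. by move=> D'D uf e /uf; apply: filterS => n un x /D'D; exact: un. Qed.

Lemma ucvg_on_cvg {T : Type} (D : set T) u (f : T -> R[i]) x :
  ucvg_on D u f -> D x -> u n x @[n --> \oo] --> f x.
Proof.
move=> uf Dx; apply/cvgrPdist_le => e e0.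
have eE : e = (Re e)%:C by rewrite RRe_real // gtr0_real.
have : 0 < Re e by rewrite -ltcR -eE.
move=> /uf; apply: filterS => n un.
by rewrite normcE_norm eE lecR normc_distC; exact: un.
Qed.

Lemma ucvg_on_uniform (D : set R[i]) (u : nat -> R[i] -> R[i])
    (f : R[i] -> R[i]) :
  ucvg_on D u f -> {uniform D, u @ \oo --> f}.
Proof.
move=> uf A /uniform_nbhs[E [entE EA]].
have [e /= e0 eE] : exists2 e : R[i], 0 < e & [set xy | ball xy.1 e xy.2] `<=` E.
  by move: entE; rewrite -entourage_ballE.
have eRe : e = (Re e)%:C by rewrite RRe_real // gtr0_real.
(* Halved because balls are open while [ucvg_on] gives a weak inequality. *)
have e2 : 0 < Re e / 2 by rewrite divr_gt0 // -ltcR -eRe.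
have := uf _ e2; apply: filterS => n un; apply: EA => z Dz; apply: eE => /=.
rewrite -ball_normE /= normcE_norm eRe ltcR normc_distC.
by apply: le_lt_trans (un z Dz) _; lra.
Qed.

End CompactUniform.

(** * Kernel polynomials *)

Section KernelPolynomials.
Context {R : realType}.
Variables (P : nat -> {poly R[i]}) (gam lam : nat -> R[i]) (g l : R^nat).
Hypothesis P_rec : recurrence_coefficients P gam lam.
Hypotheses (gamE : forall n, gam n.+1 = (g n)%:C).
Hypotheses (lamE : forall n, lam n.+2 = (l n)%:C).
Hypothesis l_ge0 : forall n, 0 <= l n.

Lemma ratio_neq0 n z : Im z != 0 -> ratio g l n z != 0.
Proof.
move=> z0; rewrite -normc_gt0.
apply: lt_le_trans (imr_le_normc _ _ z0 (imr_ratio _ _ l_ge0 n _ z0)).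
by rewrite normr_gt0.
Qed.

Let P_succ n : P n.+2 = 'X * P n.+1 - (g n.+1)%:C *: P n.+1 - (l n)%:C *: P n.
Proof.
case: P_rec => _ _ /(_ n.+1 isT) ->.
by rewrite gamE lamE /=; ring.
Qed.

(** One induction for both: the identity and r_n(z) != 0 carry nonvanishing from P_n to P_{n+1},
    which keeps the zeros off C \ R. *)
Lemma horner_ratio n z : Im z != 0 -> (P n).[z] != 0 /\
  (P n.+1).[z] = ratio g l n z * (P n).[z].
Proof.
case: P_rec => P0 P1 _ z0; elim: n => [|n [Pn0 PnE]].
  by rewrite P1 P0 gamE hornerXsubC hornerC mulr1 oner_neq0.
have r0 := ratio_neq0 n z z0.
split; first by rewrite PnE mulf_neq0.
rewrite P_succ !(hornerD, hornerN, hornerM, hornerX, hornerZ) PnE /=.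
by field.
Qed.

Lemma horner_ratioE n z : Im z != 0 ->
  (P n.+1).[z] / (P n).[z] = ratio g l n z.
Proof. by move=> z0; have [P0 ->] := horner_ratio n z z0; rewrite mulfK. Qed.

Variable k : R[i].
Hypothesis k0 : Im k != 0.

(** The Euclidean quotient is identified by exhibiting its product with X - k. *)
Let kernel_succ n : ('X - k%:P) *
    (P n.+1 + ((l n)%:C / ratio g l n k) *: kernel_poly P k n) =
  P n.+2 - ((P n.+2).[k] / (P n.+1).[k]) *: P n.+1 ->
  kernel_poly P k n.+1 = P n.+1 + ((l n)%:C / ratio g l n k) *: kernel_poly P k n.
Proof. by rewrite /kernel_poly => <-; rewrite mulKp ?polyXsubC_eq0. Qed.

Lemma kernel_poly_rec n :
  ('X - k%:P) * kernel_poly P k n =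
    P n.+1 - ((P n.+1).[k] / (P n).[k]) *: P n /\
  kernel_poly P k n.+1 =
    P n.+1 + ((l n)%:C / ratio g l n k) *: kernel_poly P k n.
Proof.
have succ m : ('X - k%:P) * kernel_poly P k m =
    P m.+1 - ((P m.+1).[k] / (P m).[k]) *: P m ->
    ('X - k%:P) * (P m.+1 + ((l m)%:C / ratio g l m k) *: kernel_poly P k m) =
    P m.+2 - ((P m.+2).[k] / (P m.+1).[k]) *: P m.+1.
  (* As r_{n+1}(k) = k - c_{n+2} - lambda_{n+2}/r_n(k), both sides equal (X - k +
     lambda_{n+2}/r_n(k)) P_{n+1} - lambda_{n+2} P_n. *)
  move=> km; rewrite mulrDr -scalerAr km !horner_ratioE // [P m.+2]P_succ /=.
  have r0 := ratio_neq0 m k k0; rewrite scalerBr scalerA divfK //.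
  rewrite -!mul_polyC !polyCB; ring.
elim: n => [|n [kn kS]]; last first.
  have kn1 := succ _ kn; rewrite -kS in kn1.
  by split=> //; apply/kernel_succ/succ.
have k1 : ('X - k%:P) * 1 = P 1%N - ((P 1%N).[k] / (P 0%N).[k]) *: P 0%N.
  case: P_rec => P0 P1 _; rewrite P0 P1 gamE hornerXsubC hornerC divr1.
  by rewrite alg_polyC polyCB; ring.
have k0E : kernel_poly P k 0 = 1.
  by rewrite /kernel_poly -k1 mulKp // polyXsubC_eq0.
have kn : ('X - k%:P) * kernel_poly P k 0 =
    P 1%N - ((P 1%N).[k] / (P 0%N).[k]) *: P 0%N by rewrite k0E.
by split=> //; apply/kernel_succ/succ.
Qed.

(** Dividing the recurrence of P*_n by P_{n+1}(z) = r_n(z) P_n(z) gives that of h_n; z = k is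
    included. *)
Lemma horner_kernel_poly n z : Im z != 0 ->
  (kernel_poly P k n).[z] = kernel_factor g l k n z * (P n).[z].
Proof.
move=> z0; elim: n => [|n IH].
  case: P_rec => P0 P1 _; rewrite /kernel_poly P0 P1 gamE hornerXsubC hornerC.
  rewrite divr1 alg_polyC [X in X %/ _](_ : _ = ('X - k%:P)); last first.
    by rewrite polyCB; ring.
  by rewrite divpp ?polyXsubC_eq0 // hornerC mulr1.
have [_ ->] := kernel_poly_rec n; have [Pn0 PnE] := horner_ratio n z z0.
rewrite hornerD hornerZ IH PnE /=.
have rz := ratio_neq0 n z z0; have rk := ratio_neq0 n k k0.
by field; apply/andP.
Qed.

End KernelPolynomials.

(** * Passage from regions to compact sets and points *)

Theorem theorem3p9 (R : realType) (L : {scalar {poly R[i]}})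
    (P : nat -> {poly R[i]}) (k : R[i]) (a c : R) (s : R[i] -> R[i])
    (L_posdef : positive_definite L) (P_OPS : monic_OPS L P)
    (k_nonreal : nonreal k) (a_ge0 : 0 <= a) (P_nevai : nevai_class a c P)
    (s_branch : sqrt_branch a c s) :
  [/\ (forall z : R[i], nonreal z ->
         (fun n => (kernel_poly P k n.+1).[z] / (kernel_poly P k n).[z]) @ \oo
           --> limit_fun c s z),
      (forall z : R[i], nonreal z ->
         (fun n => (P n.+1).[z] / (P n).[z]) @ \oo --> limit_fun c s z)
    & (forall K : set R[i], compact K -> K `<=` @nonreal R ->
         (\forall n \near \oo, forall z, K z -> (kernel_poly P k n).[z] != 0) /\
         {uniform K,
           (fun (n : nat) (z : R[i]) =>
              (kernel_poly P k n.+1).[z] / (kernel_poly P k n).[z]) @ \oo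
           --> limit_fun c s})].
Proof.
case: P_nevai => gam [lam [P_rec gam_c lam_a]].
have [g [l [gamE lamE l_ge0]]] :=
  recurrence_coefficients_real _ _ _ _ L_posdef P_OPS P_rec.
have real_cvg (u : nat -> R[i]) (v : R^nat) (b : R) m :
    u @ \oo --> b%:C -> (forall n, u (n + m)%N = (v n)%:C) -> v @ \oo --> b.
  rewrite -(cvg_shiftn m) => /cvgrPdist_le ub uv; apply/cvgrPdist_le => e e0.
  have := ub e%:C; rewrite ltcR => /(_ e0); apply: filterS => n.
  by rewrite /= uv -rmorphB normcE_norm lecR normc_real.
have g_c : g @ \oo --> c by apply: (real_cvg _ _ _ 1%N gam_c) => n; rewrite addn1.
have l_a : l @ \oo --> a by apply: (real_cvg _ _ _ 2%N lam_a) => n; rewrite addn2.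
have Fimr := limit_fun_imr _ _ _ a_ge0 s_branch.
have Ffix := limit_fun_fixed _ _ _ a_ge0 s_branch.
have kim : Im k != 0 by exact/nonrealE.
pose kratio n z := (kernel_poly P k n.+1).[z] / (kernel_poly P k n).[z].
have compact_case (K : set R[i]) : compact K -> K `<=` @nonreal R ->
    [/\ ucvg_on K (fun n z => (P n.+1).[z] / (P n).[z]) (limit_fun c s),
        \forall n \near \oo, forall z, K z -> (kernel_poly P k n).[z] != 0
      & ucvg_on K kratio (limit_fun c s)].
  move=> cK Knr; have [d [M [d0 KdM]]] := compact_sub_region K cK Knr.
  (* The region is enlarged so as to contain [k] as well as K. *)
  pose d' := Num.min d `|Im k|; pose M' := Num.max M (normc k).
  have d'0 : 0 < d' by rewrite lt_min d0 normr_gt0.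
  have KD : K `<=` region d' M'.
    apply: (subset_trans KdM); apply: regionS.
      by rewrite /d' ge_min lexx.
    by rewrite /M' le_max lexx.
  have Dk : region d' M' k by split; rewrite ?ge_min ?le_max lexx orbT.
  have Kim z : K z -> Im z != 0 by move=> /Knr/nonrealE.
  have PE n z : Im z != 0 -> (P n.+1).[z] = ratio g l n z * (P n).[z].
    by move=> z0; have [] := horner_ratio _ _ _ _ _ P_rec gamE lamE l_ge0 n z z0.
  have P0 n z : Im z != 0 -> (P n).[z] != 0.
    by move=> z0; have [] := horner_ratio _ _ _ _ _ P_rec gamE lamE l_ge0 n z z0.
  have kE := horner_kernel_poly _ _ _ _ _ P_rec gamE lamE l_ge0 _ kim.
  split.
  - have := ucvg_onS _ _ _ _ KD
      (ratio_ucvg _ _ _ _ l_ge0 a_ge0 _ Fimr Ffix g_c l_a _ M' d'0).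
    apply: vanish_on_le; apply: nearW => n z /Kim z0.
    by rewrite PE // mulfK // P0.
  - have := kernel_factor_neq0 _ _ _ _ l_ge0 a_ge0 _ Fimr Ffix g_c l_a
      _ _ d'0 _ Dk.
    apply: filterS => n fn0 z Kz; rewrite kE ?Kim // mulf_neq0 ?P0 ?Kim //.
    exact/fn0/KD.
  - have := ucvg_onS _ _ _ _ KD
      (kernel_ratio_ucvg _ _ _ _ l_ge0 a_ge0 _ Fimr Ffix g_c l_a _ _ d'0 _ Dk).
    apply: vanish_on_le; apply: nearW => n z /Kim z0.
    rewrite /kratio !kE // PE //.
    rewrite [X in normc (X - _)](_ : _ = ratio g l n z *
      (kernel_factor g l k n.+1 z / kernel_factor g l k n z)) //.
    by rewrite mulrA -mulf_div divff ?P0 // mulr1 [_ * ratio g l n z]mulrC mulrA.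
(* Pointwise limits are the case of a singleton K. *)
have point_case z : nonreal z -> compact [set z] /\ [set z] `<=` @nonreal R.
  by move=> zn; split; [exact: compact_set1|move=> _ ->].
split=> [z zn|z zn|K cK Knr].
- have [c1 n1] := point_case z zn; have [_ _ kz] := compact_case _ c1 n1.
  by apply: (ucvg_on_cvg _ _ _ _ kz).
- have [c1 n1] := point_case z zn; have [rz _ _] := compact_case _ c1 n1.
  by apply: (ucvg_on_cvg _ _ _ _ rz).
- have [_ nz kz] := compact_case _ cK Knr.
  by split=> //; exact: ucvg_on_uniform.
Qed.
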